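(* For either choice of source divergence (KL or $\chi^2$) and for all $\mathbf g\in\mathbb R^n$, the operator norm of the Hessian of $\mathcal J$ satisfies $$\|\nabla^2\mathcal J(\mathbf g)\|_{\mathrm{op}}\le\frac1\varepsilon\|\nabla\mathcal J_{\mathrm{trans}}(\mathbf g)\|_\infty+\frac{\beta_{\max}}{\rho_2}.$$
   Context: $\mathcal X,\mathcal Y$ are Polish spaces, $\mu$ is a finite nonnegative measure on $\mathcal X$, $\nu=\sum_{j=1}^n\beta_j\delta_{y_j}$ with $y_1,\dots,y_n\in\mathcal Y$, $\beta_j>0$, and $b/n\le\beta_j\le B/n$ for constants $0<b\le B$; $\beta_{\max}=\max_j\beta_j$. The cost $c:\mathcal X\times\mathcal Y\to[0,\infty)$ is continuous, and $\varepsilon,\rho_1,\rho_2>0$. For $x\in\mathcal X$, $\mathbf g\in\mathbb R^n$: $B_j(x,\mathbf g)=\beta_j\exp\big(\tfrac{g_j-c(x,y_j)}{\varepsilon}\big)$ and $Z(x,\mathbf g)=\sum_{j=1}^nB_j(x,\mathbf g)$. The semi-dual objective of entropic unbalanced optimal transport (with $\chi^2$ target penalty) is $$\mathcal J(\mathbf g)=\mathcal J_{\mathrm{trans}}(\mathbf g)+\sum_{j=1}^n\beta_j\Big(\frac{g_j^2}{2\rho_2}-g_j\Big),$$ where: - KL source: $\mathcal J_{\mathrm{trans}}(\mathbf g)=(\rho_1+\varepsilon)\int_{\mathcal X}Z(x,\mathbf g)^\alpha d\mu(x)$, with $\alpha=\frac{\varepsilon}{\varepsilon+\rho_1}$; -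 $\chi^2$ source: $\mathcal J_{\mathrm{trans}}(\mathbf g)=\frac{\varepsilon^2}{\rho_1}\int_{\mathcal X}\big(W(U(x,\mathbf g))+\tfrac12W(U(x,\mathbf g))^2\big)d\mu(x)$, with $U(x,\mathbf g)=\frac{\rho_1}{\varepsilon}e^{\rho_1/\varepsilon}Z(x,\mathbf g)$ and $W$ the Lambert function (inverse of $z\mapsto ze^z$ on $[0,\infty)$). *)

(* Defs.v *)
From HB Require Import structures.
From mathcomp Require Import all_boot all_order all_algebra.
From mathcomp Require Import all_classical all_reals all_analysis.

Set Implicit Arguments.
Unset Strict Implicit.
Unset Printing Implicit Defensive.

Import Order.TTheory GRing.Theory Num.Theory.
Import numFieldNormedType.Exports.

Local Open Scope classical_set_scope.
Local Open Scope ring_scope.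

Section Polish.
Context {R : realType}.

(* [d] is a complete metric on [T] that induces the topology of [T]. *)
Record complete_compatible_metric (T : topologicalType) (d : T -> T -> R)
    : Prop := {
  cmetric_ge0 : forall x y, 0 <= d x y ;
  cmetric_eq0 : forall x y, d x y = 0 <-> x = y ;
  cmetric_sym : forall x y, d x y = d y x ;
  cmetric_triangle : forall x y z, d x z <= d x y + d y z ;
  cmetric_nbhs : forall x (A : set T),
    nbhs x A <-> exists2 e : R, 0 < e & [set y | d x y < e] `<=` A ;
  cmetric_complete : forall u : nat -> T,
    (forall e : R, 0 < e -> exists N : nat, forall m n : nat,
       (N <= m)%N -> (N <= n)%N -> d (u m) (u n) < e) ->
    exists l : T, u @ \oo --> l }.

Definition polish_space (T : topologicalType) : Prop :=
  (exists d : T -> T -> R, complete_compatible_metric d) /\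
  (exists2 D : set T, countable D & dense D).

End Polish.

(* [X] equipped with its Borel sigma-algebra. *)
Notation borel X := (g_sigma_algebraType (@open X)).

Section Calculus.
Context {R : realType} {n : nat}.
Implicit Types (f : 'rV[R]_n -> R) (g : 'rV[R]_n).

(* Elements of R^n are row vectors; [delta_mx 0 j] is the j-th basis vector. *)
Definition grad f g : 'rV[R]_n := \row_j 'D_(delta_mx 0 j) f g.

Definition hessian f g : 'M[R]_n :=
  \matrix_(i, j) 'D_(delta_mx 0 i) (fun h => 'D_(delta_mx 0 j) f h) g.

Definition twice_differentiable f g : Prop :=
  (\forall h \near g, differentiable f h) /\ differentiable (grad f) g.

(* The library's norm on matrices is the entrywise maximum, so the Euclidean
   norm and the operator norm it induces are introduced here. *)
Definition l2norm m (v : 'cV[R]_m) : R := Num.sqrt (\sum_(i < m) v i 0 ^+ 2).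

Definition opnorm m p (A : 'M[R]_(m, p)) : R :=
  sup [set l2norm (A *m v) | v in [set v : 'cV[R]_p | l2norm v <= 1]].

End Calculus.

Definition lambertW {R : realType} : R -> R :=
  'pinv_(fun=> 0) [set z : R | 0 <= z] (fun z => z * expR z).

Variant source_divergence := KL_source | chi2_source.

Section SemiDual.
Context {R : realType} {n : nat} {X : ptopologicalType} {Y : Type}.
Variables (mu : {finite_measure set (borel X) -> \bar R}).
Variables (beta : 'I_n -> R) (y : 'I_n -> Y) (c : X -> Y -> R).
Variables (eps rho1 rho2 : R).
Implicit Types (x : X) (g : 'rV[R]_n).

Definition Bterm j x g : R := beta j * expR ((g 0 j - c x (y j)) / eps).

Definition Zsum x g : R := \sum_(j < n) Bterm j x g.

Definition Uterm x g : R := rho1 / eps * expR (rho1 / eps) * Zsum x g.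

Definition Jtrans (s : source_divergence) g : R :=
  match s with
  | KL_source =>
      (rho1 + eps) * \int[mu]_x (Zsum x g `^ (eps / (eps + rho1)))
  | chi2_source =>
      eps ^+ 2 / rho1 *
      \int[mu]_x (lambertW (Uterm x g) + 2^-1 * lambertW (Uterm x g) ^+ 2)
  end.

Definition Jdual (s : source_divergence) g : R :=
  Jtrans s g + \sum_(j < n) beta j * (g 0 j ^+ 2 / (2 * rho2) - g 0 j).

End SemiDual.

(* Main.v *)
Require Import Defs.
From HB Require Import structures.
From mathcomp Require Import all_boot all_order all_algebra.
From mathcomp Require Import all_classical all_reals all_analysis.
From mathcomp Require Import measurable_realfun ring lra.

Set Implicit Arguments.
Unset Strict Implicit.
Unset Printing Implicit Defensive.

Import Order.TTheory GRing.Theory Num.Theory.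
Import numFieldNormedType.Exports.

Local Open Scope classical_set_scope.
Local Open Scope ring_scope.

(** Both transport terms have the form of an integral over [mu] of [P (Z x g)],
    where [Z x g] is a sum of exponentials of the coordinates of [g] and [P] is
    a function on the positive reals such that [P] is increasing and concave
    while [t |-> P (exp t)] is convex: [P z = (rho1 + eps) z ^ alpha] for the KL
    source and [P z = eps ^ 2 / rho1 (W + W ^ 2 / 2)] at [W = W (kappa z)] for
    the chi-square source.  Writing [B_i] for the terms of [Z], the integrand has
    gradient [P' B_i / eps] and Hessian
    [eps ^ -2 (P'' B_i B_j + [i = j] P' B_i)].  For a direction [v] the quadratic
    form of the latter is
    [eps ^ -2 (P'' (sum_i B_i v_i) ^ 2 + P' sum_i B_i v_i ^ 2)].
    As [P'' <= 0] it is at most [eps ^ -1 sum_i v_i ^ 2 (P' B_i / eps)], that is,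
    the Hessian is dominated by [eps ^ -1] times the diagonal matrix of the
    gradient.  As [- P' <= z P''], it is at least
    [eps ^ -2 P' (sum_i B_i v_i ^ 2 - (sum_i B_i v_i) ^ 2 / Z)], which is
    nonnegative by the Cauchy-Schwarz inequality.  Both bounds survive
    integration ([transport_hess_form]) and the penalty adds the nonnegative
    diagonal matrix of the [beta_j / rho2].  So the Hessian of the objective is
    a symmetric matrix between 0 and the claimed bound times the identity, and
    its operator norm is at most that bound ([opnorm_psd_le]).

    The remaining work is to differentiate twice under the integral sign.  The
    cost may be unbounded, so [Z x g] may approach 0 and [P'], [P''] blow up.
    What stays bounded is [z * P' z]: it is nondecreasing in [z], and [Z x g] is
    bounded above locally uniformly in [g] and uniformly in [x] because the cost
    is nonnegative.  The bounds [|z P''| <= P'] and [|z ^ 2 P'''| <= 3 P'] make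
    every derivative of the integrand of order one to three at most a
    constant multiple of [z * P' z].  Thus the integrand and its partial
    derivatives have first-order Taylor expansions in [g] whose remainder is
    quadratic uniformly in [x] ([expsum_value_taylor], [expsum_slope_taylor]);
    such expansions integrate to Frechet differentiability
    ([differentiable_Rintegral]). *)

(** * Positive semidefinite forms *)

(** The form is nonnegative at [v - L^-1 A v]; expanding it there bounds
    [|A v|^2] by [L^2 |v|^2], without diagonalising [A]. *)
Lemma psd_l2norm_le (R : realType) (n : nat) (A : 'M[R]_n) (L : R) :
  0 < L -> A^T = A ->
  (forall v : 'cV[R]_n, 0 <= (v^T *m A *m v) 0 0 <= L * (v^T *m v) 0 0) ->
  forall v : 'cV[R]_n, l2norm (A *m v) <= L * l2norm v.
Proof.
move=> L0 symA hA v.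
have sqE (u : 'cV[R]_n) : \sum_i u i 0 ^+ 2 = (u^T *m u) 0 0.
  by rewrite mxE; apply: eq_bigr => i _; rewrite mxE expr2.
have sq_ge0 (u : 'cV[R]_n) : 0 <= (u^T *m u) 0 0.
  by rewrite -sqE; apply: sumr_ge0 => i _; exact: sqr_ge0.
pose w := A *m v.
have q t : (v - t *: w)^T *m A *m (v - t *: w) =
   v^T *m A *m v - (2 * t) *: (w^T *m w) + t ^+ 2 *: (w^T *m A *m w).
  have wTv : w^T *m A *m v = w^T *m w by rewrite -mulmxA.
  have vTw : v^T *m A *m w = w^T *m w by rewrite /w trmx_mul symA.
  have -> : (v - t *: w)^T = v^T - t *: w^T.
    by apply/matrixP => i j; rewrite !mxE.
  rewrite !mulmxBl !mulmxBr -!scalemxAl.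
  rewrite -?scalemxAr -?scalemxAl wTv vTw scalerA.
  apply/matrixP => i j; rewrite !mxE; ring.
(* [t = L^-1] minimises the bound [- 2 t |w|^2 + t^2 L |w|^2] along [w]. *)
have := hA (v - L^-1 *: w); rewrite q => /andP[+ _].
have /andP[_ hv] := hA v; have /andP[_ hw] := hA w.
rewrite !mxE => h0.
have hww : (w^T *m w) 0 0 <= L ^+ 2 * (v^T *m v) 0 0.
  move: h0 hv hw; rewrite ![(_ *m _) 0 0]mxE.
  set a := \sum_j _; set b := \sum_j _; set c := \sum_j _.
  set d := \sum_j _ => h0 h1 h2.
  have h3 : L^-1 ^+ 2 * c <= L^-1 * b.
    by rewrite expr2 -mulrA ler_pM2l ?invr_gt0// ler_pdivrMl.
  have : L^-1 * b <= L * d by lra.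
  by rewrite ler_pdivrMl// mulrA -expr2.
rewrite /l2norm !sqE -/w -[X in _ <= X * _](ger0_norm (ltW L0)) -sqrtr_sqr.
by rewrite -sqrtrM ?sqr_ge0// ler_wsqrtr.
Qed.

Lemma opnorm_psd_le (R : realType) (n : nat) (A : 'M[R]_n) (L : R) :
  0 < L -> A^T = A ->
  (forall v : 'cV[R]_n, 0 <= (v^T *m A *m v) 0 0 <= L * (v^T *m v) 0 0) ->
  opnorm A <= L.
Proof.
move=> L0 symA hA; apply: ge_sup.
  exists (l2norm (A *m (0 : 'cV[R]_n))), 0 => //=.
  by rewrite /l2norm big1 ?sqrtr0// => i _; rewrite mxE expr0n.
move=> _ [v /= v1 <-]; apply: le_trans (psd_l2norm_le L0 symA hA v) _.
by rewrite ler_piMr// ltW.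
Qed.

(** The difference of the two sides is [sum_i w_i] times the weighted variance
    of [v]. *)
Lemma weighted_cauchy_schwarz (R : realFieldType) (n : nat) (w v : 'I_n -> R) :
  (forall i, 0 <= w i) -> 0 < \sum_i w i ->
  (\sum_i w i * v i) ^+ 2 <= (\sum_i w i) * \sum_i w i * v i ^+ 2.
Proof.
move=> w0 W0; set W := \sum_i w i; set S := \sum_i w i * v i.
have: 0 <= \sum_i w i * (v i - S / W) ^+ 2.
  by apply: sumr_ge0 => i _; rewrite mulr_ge0 ?sqr_ge0.
have -> : \sum_i w i * (v i - S / W) ^+ 2 =
    \sum_i w i * v i ^+ 2 - W^-1 * S ^+ 2.
  transitivity (\sum_i (w i * v i ^+ 2 - (2 * (S / W)) * (w i * v i)
                  + (S / W) ^+ 2 * w i)).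
    by apply: eq_bigr => i _; ring.
  rewrite !big_split/= sumrN -!mulr_sumr -/S -/W.
  by field; rewrite gt_eqF.
by rewrite subr_ge0 ler_pdivrMl.
Qed.

(** * The Lambert function *)

Section Lambert.
Context {R : realType}.
Implicit Types z u : R.

Let f z : R := z * expR z.

Lemma is_derive_mul_expR z :
  is_derive z 1 (fun z => z * expR z) (expR z * (1 + z)).
Proof.
apply: is_derive_eq.
by rewrite /GRing.scale/=; ring.
Qed.

Lemma lambertWK u : 0 <= u -> lambertW u * expR (lambertW u) = u.
Proof.
move=> u0; apply: (@pinvK R R (fun=> 0) [set z : R | 0 <= z] f); rewrite inE /=.
have cf : {within `[0, u], continuous f}.
  apply: continuous_subspaceT => z; apply: differentiable_continuous.
  exact/derivable1_diffP/(@ex_derive _ _ _ _ _ _ _ (is_derive_mul_expR z)).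
have [|z /andP[z0 _] fz] := @IVT R f 0 u u u0 cf; last by exists z; rewrite // -fz.
rewrite /f mul0r ge_min le_max u0 /= orbC ler_peMr//.
by rewrite -expR0 ler_expR.
Qed.

Lemma lambertW_gt0 u : 0 < u -> 0 < lambertW u.
Proof.
move=> u0; rewrite -(@pmulr_lgt0 _ (expR (lambertW u))) ?expR_gt0//.
by rewrite lambertWK// ltW.
Qed.

Lemma mul_expR_inj : {in [set z : R | 0 <= z] &, injective f}.
Proof.
suff lt_f z w : 0 <= z -> z < w -> f z < f w.
  move=> z w; rewrite !inE /= => z0 w0 fzw.
  have [zw|wz|//] := ltgtP z w.
    by have := lt_f _ _ z0 zw; rewrite fzw ltxx.
  by have := lt_f _ _ w0 wz; rewrite fzw ltxx.
move=> z0 zw; rewrite ltr_pM ?expR_ge0// ltr_expR//.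
Qed.

Lemma mul_expRK z : 0 <= z -> lambertW (f z) = z.
Proof.
move=> z0; apply: (@pinvKV R R (fun=> 0) [set z : R | 0 <= z] f mul_expR_inj).
by rewrite inE.
Qed.

Lemma is_derive_lambertW u : 0 < u ->
  is_derive u 1 lambertW (expR (- lambertW u) / (1 + lambertW u)).
Proof.
move=> u0; set w := lambertW u; have w0 : 0 < w by exact: lambertW_gt0.
have fw : f w = u by apply: lambertWK; exact: ltW.
have -> : expR (- w) / (1 + w) = (expR w * (1 + w))^-1.
  by rewrite expRN invfM.
rewrite -fw; apply: (@is_derive_inverse R f).
- near=> z; apply: mul_expRK; apply: ltW; near: z.
  exact: lt_nbhsr.
- near=> z; apply: differentiable_continuous.
  exact/derivable1_diffP/(@ex_derive _ _ _ _ _ _ _ (is_derive_mul_expR z)).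
- exact: is_derive_mul_expR.
- by rewrite mulf_neq0 ?gt_eqF ?expR_gt0// addr_gt0.
Unshelve. all: by end_near. Qed.

End Lambert.

(** * Elastic profiles *)

(** The functions [P] through which the source divergence enters; [P1], [P2] and
    [P3] are its first three derivatives.  The two bounds on [P2] say that [P] is
    concave and that [t |-> P (exp t)] is convex: they are the upper and the lower
    bound on the Hessian.  The bound on [P3] gives uniform Taylor remainders for
    the gradient; 3 is a constant that suits both divergences. *)
Record elastic_profile (R : realType) (P P1 P2 P3 : R -> R) : Prop := {
  profile_ge0 : forall z : R, 0 < z -> 0 <= P z ;
  profile_derive : forall z : R, 0 < z -> is_derive z 1 P (P1 z) ;
  profile_derive1 : forall z : R, 0 < z -> is_derive z 1 P1 (P2 z) ;
  profile_derive2 : forall z : R, 0 < z -> is_derive z 1 P2 (P3 z) ;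
  profile1_ge0 : forall z : R, 0 < z -> 0 <= P1 z ;
  profile2_le0 : forall z : R, 0 < z -> P2 z <= 0 ;
  profile2_ge : forall z : R, 0 < z -> - P1 z <= z * P2 z ;
  profile3_le : forall z : R, 0 < z -> `|z ^+ 2 * P3 z| <= 3 * P1 z }.

Lemma powR_profile (R : realType) (k a : R) : 0 <= k -> 0 <= a <= 1 ->
  elastic_profile (fun z => k * z `^ a) (fun z => k * (a * z `^ (a - 1)))
    (fun z => k * (a * ((a - 1) * z `^ (a - 1 - 1))))
    (fun z => k * (a * ((a - 1) * ((a - 1 - 1) * z `^ (a - 1 - 1 - 1))))).
Proof.
move=> k0 /andP[a0 a1].
have dpow (m b z : R) : 0 < z ->
    is_derive z 1 (fun z => m * z `^ b) (m * (b * z `^ (b - 1))).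
  by move=> z0; exact: (is_deriveZ m (is_derive1_powR b z0)).
have stepd (b z : R) : 0 < z -> z * z `^ (b - 1) = z `^ b.
  move=> z0; rewrite -[X in X * _]powRr1 ?ltW// -powRD.
    by congr (_ `^ _); ring.
  by rewrite (gt_eqF z0) implybT.
split=> z z0.
- by rewrite mulr_ge0 ?powR_ge0.
- exact: dpow.
- under eq_fun do rewrite mulrA.
  by rewrite mulrA; exact: dpow.
- under eq_fun do rewrite !mulrA.
  by rewrite !mulrA -[X in is_derive _ _ _ X]mulrA; exact: dpow.
- by rewrite !mulr_ge0 ?powR_ge0.
- have a10 : a - 1 <= 0 by lra.
  by rewrite mulr_ge0_le0// mulr_ge0_le0// mulr_le0_ge0// powR_ge0.
- have -> : z * (k * (a * ((a - 1) * z `^ (a - 1 - 1)))) =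
      (a - 1) * (k * (a * z `^ (a - 1))).
    rewrite -(stepd (a - 1) z z0); ring.
  have : 0 <= k * (a * z `^ (a - 1)) by rewrite !mulr_ge0 ?powR_ge0.
  by nra.
- have -> : z ^+ 2 * (k * (a * ((a - 1) * ((a - 1 - 1) * z `^ (a - 1 - 1 - 1))))) =
      (a - 1) * (a - 2) * (k * (a * z `^ (a - 1))).
    rewrite -(stepd (a - 1) z z0) -(stepd (a - 1 - 1) z z0); ring.
  have p0 : 0 <= k * (a * z `^ (a - 1)) by rewrite !mulr_ge0 ?powR_ge0.
  rewrite normrM [X in _ * X <= _]ger0_norm// ler_wpM2r// ler_norml.
  by apply/andP; split; nra.
Qed.

(** Differentiating [W exp W = u] gives [W' = exp (- W) / (1 + W)], so that
    [(W + W ^ 2 / 2)' = exp (- W)].  With [u exp (- W) = W], the products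
    [z P2] and [z ^ 2 P3] become [P1] times the rational functions
    [- W / (1 + W)] and [W ^ 2 / (1 + W) ^ 2 (2 + 1 / (1 + W))] of [W >= 0]. *)
Lemma lambert_profile (R : realType) (m k : R) : 0 <= m -> 0 < k ->
  let W (z : R) := lambertW (k * z) in
  elastic_profile
    (fun z : R => m * (W z + 2^-1 * W z ^+ 2))
    (fun z : R => m * k * expR (- W z))
    (fun z : R => - (m * k ^+ 2) * (expR (- W z) ^+ 2 / (1 + W z)))
    (fun z : R => m * k ^+ 3 * expR (- W z) ^+ 3
                * (2 / (1 + W z) ^+ 2 + (1 + W z) ^- 3)).
Proof.
move=> m0 k0 W.
have kz0 (z : R) : 0 < z -> 0 < k * z by move=> z0; rewrite mulr_gt0.
have W0 (z : R) : 0 < z -> 0 < W z by move=> /kz0 /lambertW_gt0.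
have dk (z : R) : is_derive z 1 (fun z : R => k * z) k.
  apply: (is_derive_eq (is_deriveZ k (is_derive_id z 1))).
  by rewrite /GRing.scale/= mulr1.
have dW (z : R) : 0 < z -> is_derive z 1 W (k * (expR (- W z) / (1 + W z))).
  move=> z0; rewrite mulrC.
  exact: (is_derive1_comp (is_derive_lambertW (kz0 _ z0)) (dk z)).
have dE (z : R) : 0 < z ->
    is_derive z 1 (fun z : R => expR (- W z))
      (- k * (expR (- W z) ^+ 2 / (1 + W z))).
  move=> z0; apply: (is_derive_eq
    (is_derive1_comp (is_derive_expR _) (is_deriveN (dW z z0)))).
  by rewrite /=; ring.
have dV (z : R) : 0 < z -> is_derive z 1 (fun z : R => (1 + W z)^-1)
    (- k * (expR (- W z) / (1 + W z) ^+ 3)).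
  move=> z0; have wz : (cst 1 + W) z != 0 by rewrite /= gt_eqF// addr_gt0 ?W0.
  have D1 : is_derive z 1 (cst 1 + W) _ :=
    is_deriveD (is_derive_cst (1 : R) z 1) (dW z z0).
  apply: (is_derive_eq (is_deriveV wz D1)).
  by rewrite /GRing.scale/= add0r -[(cst 1 + W) z]/(1 + W z); field.
(* Trades powers of [z] for powers of [W z]. *)
have EK (z : R) : 0 < z -> k * z * expR (- W z) = W z.
  move=> z0; rewrite -{1}(lambertWK (ltW (kz0 _ z0))) -/(W z) -mulrA -expRD.
  by rewrite subrr expR0 mulr1.
split=> z z0; have w0 := W0 z z0;
  have w1 : 1 + W z != 0 by rewrite gt_eqF// addr_gt0.
- by rewrite mulr_ge0// addr_ge0 ?mulr_ge0 ?sqr_ge0 ?invr_ge0// ltW.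
- apply: (is_derive_eq (is_deriveZ m
    (is_deriveD (dW z z0) (is_deriveZ 2^-1 (is_deriveX 2 (dW z z0)))))).
  by rewrite /GRing.scale/= ?fctE; field.
- apply: (is_derive_eq (is_deriveZ (m * k) (dE z z0))).
  by rewrite /GRing.scale/=; ring.
- apply: (is_derive_eq (is_deriveZ (- (m * k ^+ 2))
    (is_deriveM (is_deriveX 2 (dE z z0)) (dV z z0)))).
  by rewrite /GRing.scale/= ?fctE; field.
- by rewrite !mulr_ge0 ?expR_ge0// ltW.
- by rewrite mulNr oppr_le0 !mulr_ge0 ?sqr_ge0 ?expR_ge0 ?invr_ge0// ltW// addr_gt0.
- have -> : z * (- (m * k ^+ 2) * (expR (- W z) ^+ 2 / (1 + W z))) =
      - (m * k * expR (- W z)) * (W z / (1 + W z)).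
    by rewrite -[X in _ = _ * (X / _)](EK z z0); ring.
  rewrite mulNr lerN2 ler_piMr ?mulr_ge0 ?expR_ge0//; first exact: ltW.
  by rewrite ler_pdivrMr; lra.
- have -> : z ^+ 2 * (m * k ^+ 3 * expR (- W z) ^+ 3
                * (2 / (1 + W z) ^+ 2 + (1 + W z) ^- 3)) =
      (W z ^+ 2 * (2 / (1 + W z) ^+ 2 + (1 + W z) ^- 3)) * (m * k * expR (- W z)).
    by rewrite -[X in _ = X ^+ 2 * _ * _](EK z z0); ring.
  have p0 : 0 <= m * k * expR (- W z) by rewrite !mulr_ge0 ?expR_ge0// ltW.
  have i0 : 0 < (1 + W z)^-1 by rewrite invr_gt0; lra.
  rewrite normrM [X in _ * X <= _]ger0_norm// ler_wpM2r// ger0_norm; last first.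
    by rewrite mulr_ge0 ?sqr_ge0// addr_ge0 ?mulr_ge0// -?exprVn ?exprn_ge0// ltW.
  have x1 : W z / (1 + W z) <= 1 by rewrite ler_pdivrMr; lra.
  have x0 : 0 <= W z / (1 + W z) by rewrite mulr_ge0 ?ltW.
  have i1 : (1 + W z)^-1 <= 1 by rewrite invf_le1; lra.
  have -> : W z ^+ 2 * (2 / (1 + W z) ^+ 2 + (1 + W z) ^- 3) =
      (W z / (1 + W z)) ^+ 2 * (2 + (1 + W z)^-1) by field.
  have : (W z / (1 + W z)) ^+ 2 <= 1 by rewrite expr_le1.
  have := sqr_ge0 (W z / (1 + W z)).
  nra.
Qed.

(** * Differentiation under the integral sign *)

Lemma taylor1_le (R : realType) (f f1 f2 : R -> R) (K : R) :
  (forall t : R, is_derive t 1 f (f1 t)) ->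
  (forall t : R, is_derive t 1 f1 (f2 t)) ->
  (forall t, 0 <= t <= 1 -> `|f2 t| <= K) ->
  `|f 1 - f 0 - f1 0| <= K.
Proof.
move=> df df1 f2K.
have cont (h h1 : R -> R) : (forall t : R, is_derive t 1 h (h1 t)) ->
    forall a b : R, {within `[a, b], continuous h}.
  move=> dh a b; apply: continuous_subspaceT => t.
  exact/differentiable_continuous/derivable1_diffP/(@ex_derive _ _ _ _ _ _ _ (dh t)).
have [s s01 ->] := MVT ltr01 (fun t _ => df t) (cont _ _ df 0 1).
have [s0 s1] : 0 < s /\ s < 1 by move: s01; rewrite in_itv /= => /andP.
have [r rs] := MVT s0 (fun t _ => df1 t) (cont _ _ df1 0 s).
have [r0 r1] : 0 < r /\ r < s by move: rs; rewrite in_itv /= => /andP.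
rewrite !subr0 mulr1 => ->; rewrite normrM (ger0_norm (ltW s0)).
apply: (@le_trans _ _ `|f2 r|); first by rewrite ler_piMr// ltW.
by apply: f2K; lra.
Qed.

Lemma differentiable_quadratic_remainder (R : realType) (n : nat)
    (f : 'rV[R]_n -> R) (g : 'rV[R]_n) (d : 'I_n -> R) (C : R) :
  (forall v, `|v| <= 1 ->
     `|f (g + v) - f g - \sum_j d j * v 0 j| <= C * `|v| ^+ 2) ->
  differentiable f g /\ forall j, 'D_(delta_mx 0 j) f g = d j.
Proof.
move=> fC.
pose L (v : 'rV[R]_n) : R := \sum_j d j * v 0 j.
have linL : linear L.
  move=> a u v; rewrite /L scaler_sumr -big_split /=; apply: eq_bigr => j _.
  by rewrite !mxE /GRing.scale /=; ring.
pose LM := GRing.isLinear.Build _ _ _ _ _ linL.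
pose LL : {linear _ -> _} := HB.pack L LM.
have cL : continuous LL.
  rewrite -[X in continuous X]/L /L.
  apply: (@continuous_big R 'I_n +%R 0 xpredT (@add_continuous R)) => j _ v.
  apply: (@continuousM _ _ (cst (d j)) (fun v : 'rV[R]_n => v 0 j)).
    exact: cst_continuous.
  exact: coord_continuous.
suff fL : forall e : R, 0 < e -> \forall v \near (0 : 'rV[R]_n),
    `|(f \o shift g - (cst (f g) + LL)) v| <= e * `|v|.
  have [dE dL] : 'd f g = LL :> ('rV[R]_n -> R) /\ differentiable f g.
    have fE := (eqaddoP _ _ _ _).2 fL.
    have dE := diff_unique cL fE.
    by split=> //; apply/diff_locallyP; rewrite dE.
  split=> // j; rewrite deriveE// dE /= /L (bigD1 j)//= big1 ?addr0.
    by rewrite mxE !eqxx mulr1.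
  by move=> i ij; rewrite mxE eqxx (negbTE ij) mulr0.
move=> e e0; have C0 : 0 < `|C| + 1 by rewrite ltr_wpDl.
near=> v.
have v1 : `|v| <= 1 by near: v; exact: (@nbhs0_le R 'rV[R]_n 1 ltr01).
have ve : `|v| <= (`|C| + 1)^-1 * e.
  by near: v; apply: (@nbhs0_le R 'rV[R]_n); rewrite mulr_gt0 ?invr_gt0.
have -> : (f \o shift g - (cst (f g) + LL)) v = f (g + v) - f g - \sum_j d j * v 0 j.
  by rewrite !fctE /= (addrC v) opprD addrA.
apply: le_trans (fC v v1) _; rewrite expr2 mulrA ler_wpM2r//.
apply: (@le_trans _ _ ((`|C| + 1) * `|v|)); last by rewrite -ler_pdivlMl.
by rewrite ler_wpM2r// ler_wpDr// ler_norm.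
Unshelve. all: by end_near. Qed.

Section IntegralCalculus.
Context {R : realType} {d : measure_display} {T : measurableType d}.
Variable mu : {finite_measure set T -> \bar R}.

Let intble (f : T -> R) := mu.-integrable setT (EFin \o f).

Lemma Rintegral_lincomb (I : Type) (s : seq I) (a : I -> R) (F : I -> T -> R) :
  (forall i, intble (F i)) ->
  intble (fun x => \sum_(i <- s) a i * F i x) /\
  \int[mu]_x (\sum_(i <- s) a i * F i x) = \sum_(i <- s) a i * \int[mu]_x F i x.
Proof.
move=> iF; have iaF i : intble (fun x => a i * F i x).
  exact: (integrableZl measurableT (a i) (iF i)).
elim: s => [|i s [iS eS]].
  split; last first.
    by under eq_Rintegral do rewrite big_nil; rewrite big_nil Rintegral_cst// mul0r.
  by rewrite /intble; under eq_fun do rewrite big_nil; exact: integrable0.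
split.
  rewrite /intble; under eq_fun do rewrite big_cons.
  exact: (integrableD measurableT (iaF i) iS).
under eq_Rintegral do rewrite big_cons.
by rewrite big_cons (RintegralD measurableT (iaF i) iS) eS RintegralZl//; exact: iF.
Qed.

(** A quadratic remainder with a constant independent of [x] replaces the
    dominated convergence argument and yields the full differential, not only
    the partial derivatives. *)
Lemma differentiable_Rintegral (n : nat) (f : T -> 'rV[R]_n -> R)
    (g : 'rV[R]_n) (D : 'I_n -> T -> R) (C : R) :
  (forall h, intble (fun x => f x h)) -> (forall j, intble (D j)) ->
  (forall x v, `|v| <= 1 ->
     `|f x (g + v) - f x g - \sum_j D j x * v 0 j| <= C * `|v| ^+ 2) ->
  differentiable (fun h => \int[mu]_x f x h) g /\
  forall j, 'D_(delta_mx 0 j) (fun h => \int[mu]_x f x h) g = \int[mu]_x D j x.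
Proof.
move=> iff iD fC.
apply: (@differentiable_quadratic_remainder _ _ _ _ _ (C * fine (mu setT))) => v v1.
have [iS eS] := Rintegral_lincomb (index_enum 'I_n) (v 0) iD.
under [X in _ - X]eq_bigr do rewrite mulrC.
have iB := integrableB measurableT (iff (g + v)) (iff g).
rewrite -eS -(RintegralB measurableT (iff (g + v)) (iff g)).
rewrite -(RintegralB measurableT iB iS).
apply: le_trans (le_normr_Rintegral measurableT _) _.
  exact: (integrableB measurableT iB iS).
apply: (@le_trans _ _ (\int[mu]_x (cst (C * `|v| ^+ 2) x))).
  apply: le_Rintegral => //.
  - exact: (integrable_norm (integrableB measurableT iB iS)).
  - exact: finite_measure_integrable_cst.
  - move=> x _ /=; under eq_bigr do rewrite mulrC.
    exact: fC.
by rewrite Rintegral_cst// mulrAC.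
Qed.

End IntegralCalculus.

Lemma integrable_continuous_bounded (R : realType) (X : ptopologicalType)
    (mu : {finite_measure set (borel X) -> \bar R}) (f : X -> R) (M : R) :
  continuous f -> (forall x, `|f x| <= M) ->
  mu.-integrable setT (EFin \o (f : borel X -> R)).
Proof.
move=> cf fM.
apply: (@le_integrable _ _ _ mu setT measurableT _ (EFin \o cst M)).
- apply/measurable_EFinP; apply: (measurability _ (RGenOpens.measurableE R)).
  move=> _ [_ [a [b ->] <-]]; rewrite setTI; apply: sub_sigma_algebra.
  by move/continuousP : cf; apply; exact: interval_open.
- by move=> x _; rewrite lee_fin /= (le_trans (fM x))// ler_norm.
- exact: finite_measure_integrable_cst.
Qed.

Lemma ge0_derive_le (R : realType) (f f1 : R -> R) (a b : R) :
  (forall z : R, 0 < z -> is_derive z 1 f (f1 z)) ->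
  (forall z : R, 0 < z -> 0 <= f1 z) ->
  0 < a -> a <= b -> f a <= f b.
Proof.
move=> df f1_ge0 a0 ab.
have dfab (z : R) : z \in `[a, b]%R -> is_derive z 1 f (f1 z).
  by rewrite in_itv /= => /andP[az _]; apply/df/(lt_le_trans a0).
have dfoo (z : R) : z \in `]a, b[%R -> is_derive z 1 f (f1 z).
  by move=> zab; apply/dfab/subset_itv_oo_cc.
have fc : {within `[a, b], continuous f}.
  apply: derivable_within_continuous => z /dfab dz.
  exact: (@ex_derive _ _ _ _ _ _ _ dz).
have [z zab E] := MVT_segment ab dfoo fc.
rewrite -subr_ge0 E mulr_ge0 ?subr_ge0// f1_ge0// (lt_le_trans a0)//.
by move: zab; rewrite in_itv /= => /andP[].
Qed.

Section ProfileMonotony.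
Context {R : realType}.
Variables P P1 P2 P3 : R -> R.
Hypothesis prof : elastic_profile P P1 P2 P3.

Lemma profile_le (a b : R) : 0 < a -> a <= b -> P a <= P b.
Proof.
exact: ge0_derive_le (profile_derive prof) (profile1_ge0 prof).
Qed.

(** [z * P1 z] is the derivative of the convex function [t |-> P (exp t)] at
    [t = ln z]. *)
Lemma profile_slope_le (a b : R) : 0 < a -> a <= b -> a * P1 a <= b * P1 b.
Proof.
apply: (@ge0_derive_le _ (fun z => z * P1 z) (fun z => z * P2 z + P1 z)) => z z0.
  apply: (is_derive_eq (is_deriveM (is_derive_id z 1) (profile_derive1 prof z0))).
  by rewrite /GRing.scale /= mulr1.
by rewrite -lerBlDr sub0r (profile2_ge prof).
Qed.

End ProfileMonotony.

(** * Taylor expansions of profiles of exponential sums *)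

Section ExponentialSums.
Context {R : realType} {n : nat}.
Variables (a k : 'I_n -> R) (r G : R).
Variables P P1 P2 P3 : R -> R.
Hypothesis n_gt0 : (0 < n)%N.
Hypothesis a_gt0 : forall i, 0 < a i.
Hypothesis k_le : forall i, `|k i| <= r.
Hypothesis prof : elastic_profile P P1 P2 P3.

(** Coefficients and exponents are kept apart, so that differentiating an
    exponential sum only multiplies its coefficients by the exponents. *)
Definition expsum (c : 'I_n -> R) (t : R) : R := \sum_i c i * expR (t * k i).

Lemma is_derive_exp_term (c l t : R) :
  is_derive t 1 (fun t => c * expR (t * l)) (c * l * expR (t * l)).
Proof.
have dl : is_derive t 1 (fun t : R => t * l) l.
  apply: (is_derive_eq (is_deriveM (is_derive_id t 1) (is_derive_cst l t 1))).
  by rewrite /GRing.scale /= mulr0 mulr1 add0r.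
apply: (is_derive_eq (is_deriveZ c (is_derive1_comp (is_derive_expR _) dl))).
by rewrite /GRing.scale /=; ring.
Qed.

Lemma is_derive_expsum (c : 'I_n -> R) (t : R) :
  is_derive t 1 (expsum c) (expsum (fun i => c i * k i) t).
Proof.
have -> : expsum c = \sum_i (fun t => c i * expR (t * k i)).
  by apply/funext => s; rewrite fct_sumE.
by apply: is_derive_sum => i; exact: is_derive_exp_term.
Qed.

Lemma expsum_gt0 (t : R) : 0 < expsum a t.
Proof.
rewrite /expsum (bigD1 (Ordinal n_gt0))//= ltr_pwDl ?mulr_gt0 ?expR_gt0//.
by apply: sumr_ge0 => i _; rewrite mulr_ge0 ?expR_ge0// ltW.
Qed.

Lemma exp_term_le (i : 'I_n) (t : R) : a i * expR (t * k i) <= expsum a t.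
Proof.
rewrite /expsum (bigD1 i)//= lerDl; apply: sumr_ge0 => j _.
by rewrite mulr_ge0 ?expR_ge0// ltW.
Qed.

Lemma expsum_moment1_le (t : R) :
  `|expsum (fun i => a i * k i) t| <= r * expsum a t.
Proof.
rewrite /expsum mulr_sumr; apply: le_trans (ler_norm_sum _ _ _) _.
apply: ler_sum => i _; rewrite !normrM (gtr0_norm (a_gt0 i)).
rewrite (gtr0_norm (expR_gt0 _)) mulrAC [leRHS]mulrC.
by rewrite ler_wpM2l// mulr_ge0 ?expR_ge0// ltW.
Qed.

Lemma expsum_moment2_le (t : R) :
  `|expsum (fun i => a i * k i * k i) t| <= r ^+ 2 * expsum a t.
Proof.
rewrite /expsum mulr_sumr; apply: le_trans (ler_norm_sum _ _ _) _.
apply: ler_sum => i _; set e := expR _; have e0 : 0 < e := expR_gt0 _.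
rewrite (_ : _ * e = a i * e * k i ^+ 2); last by ring.
have ae0 : 0 <= a i * e by rewrite mulr_ge0// ltW.
rewrite normrM (ger0_norm ae0) [leLHS]mulrC ler_wpM2r//.
by rewrite normrX lerXn2r// nnegrE// (le_trans _ (k_le i)).
Qed.

(** [G] is the only size that enters the remainders below: [expsum a] may be
    arbitrarily small, and [P1] unbounded near 0. *)
Hypothesis slope_le : forall t, 0 <= t <= 1 -> expsum a t * P1 (expsum a t) <= G.

(** With [S] the sum, [(P o S)'' = P2 S'^2 + P1 S''] where [|S'| <= r S] and
    [|S''| <= r^2 S]; each term is at most [r^2 S P1(S)]. *)
Lemma expsum_value_taylor :
  `|P (expsum a 1) - P (expsum a 0) -
    P1 (expsum a 0) * expsum (fun i => a i * k i) 0| <= 2 * r ^+ 2 * G.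
Proof.
have dZ := is_derive_expsum a.
have dZ1 := is_derive_expsum (fun i => a i * k i).
set Z := expsum a in dZ *; set Z1 := expsum _ in dZ dZ1 *.
set Z2 := expsum _ in dZ1.
apply: (@taylor1_le _ (P \o Z) (fun t => P1 (Z t) * Z1 t)
         (fun t => P2 (Z t) * Z1 t ^+ 2 + P1 (Z t) * Z2 t)).
- move=> t; exact: (is_derive1_comp (profile_derive prof (expsum_gt0 t)) (dZ t)).
- move=> t.
  have d1 := is_derive1_comp (profile_derive1 prof (expsum_gt0 t)) (dZ t).
  by apply: (is_derive_eq (is_deriveM d1 (dZ1 t))); rewrite /GRing.scale /=; ring.
move=> t t01.
have Z0 : 0 < Z t := expsum_gt0 t.
have := slope_le t01; have := expsum_moment1_le t; have := expsum_moment2_le t.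
rewrite -/Z -/Z1 -/Z2 => h2 h1 hG.
have p1 := profile1_ge0 prof Z0; have p2 := profile2_le0 prof Z0.
have p2' := profile2_ge prof Z0.
have h12 : Z1 t ^+ 2 <= r ^+ 2 * Z t ^+ 2.
  rewrite -(real_normK (num_real (Z1 t))) -exprMn lerXn2r// nnegrE.
  exact: le_trans h1.
have r2 := sqr_ge0 r.
have e1 : `|P2 (Z t) * Z1 t ^+ 2| <= r ^+ 2 * (Z t * P1 (Z t)).
  rewrite normrM (ler0_norm p2) (ger0_norm (sqr_ge0 _)).
  apply: (@le_trans _ _ (- P2 (Z t) * (r ^+ 2 * Z t ^+ 2))).
    by rewrite ler_wpM2l// oppr_ge0.
  have -> : - P2 (Z t) * (r ^+ 2 * Z t ^+ 2) =
    r ^+ 2 * (Z t * - (Z t * P2 (Z t))) by ring.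
  by rewrite ler_wpM2l// (ler_wpM2l (ltW Z0))// lerNl.
have e2 : `|P1 (Z t) * Z2 t| <= r ^+ 2 * (Z t * P1 (Z t)).
  rewrite normrM (ger0_norm p1); apply: le_trans (ler_wpM2l p1 h2) _.
  by rewrite mulrCA (mulrC (P1 _)).
apply: le_trans (ler_normD _ _) _.
have := ler_wpM2l r2 hG; lra.
Qed.

(** The constant 7 collects the four terms of the second derivative of
    [P1(S) b]: [P3 S'^2 b] counts three times, [P2 S'' b] and [P1 b''] once and
    [P2 S' b'] twice. *)
Lemma expsum_slope_taylor (i : 'I_n) (b := fun t => a i * expR (t * k i)) :
  `|P1 (expsum a 1) * b 1 - P1 (expsum a 0) * b 0 -
    (P2 (expsum a 0) * expsum (fun i => a i * k i) 0 * b 0 +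
     P1 (expsum a 0) * (b 0 * k i))| <= 7 * r ^+ 2 * G.
Proof.
have dZ := is_derive_expsum a.
have dZ1 := is_derive_expsum (fun i => a i * k i).
have db (t : R) : is_derive t 1 b (b t * k i).
  by apply: (is_derive_eq (is_derive_exp_term _ _ _)); rewrite /b; ring.
have bZ t : b t <= expsum a t := exp_term_le i t.
have b0 t : 0 <= b t by rewrite mulr_ge0 ?expR_ge0// ltW.
set Z := expsum a in dZ bZ *; set Z1 := expsum _ in dZ dZ1 *.
set Z2 := expsum _ in dZ1; clearbody b.
have dP1 (t : R) := is_derive1_comp (profile_derive1 prof (expsum_gt0 t)) (dZ t).
have dP2 (t : R) := is_derive1_comp (profile_derive2 prof (expsum_gt0 t)) (dZ t).
apply: (@taylor1_le _ (fun t => P1 (Z t) * b t)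
         (fun t => P2 (Z t) * Z1 t * b t + P1 (Z t) * (b t * k i))
         (fun t => P3 (Z t) * Z1 t ^+ 2 * b t + P2 (Z t) * Z2 t * b t
                   + 2 * (P2 (Z t) * Z1 t * (b t * k i))
                   + P1 (Z t) * (b t * k i ^+ 2))).
- move=> t; apply: (is_derive_eq (is_deriveM (dP1 t) (db t))).
  by rewrite /GRing.scale /=; ring.
- move=> t; apply: (is_derive_eq (is_deriveD
      (is_deriveM (is_deriveM (dP2 t) (dZ1 t)) (db t))
      (is_deriveM (dP1 t) (is_deriveM (db t) (is_derive_cst (k i) t 1))))).
  by rewrite /GRing.scale /= ?fctE; ring.
move=> t t01.
have Z0 : 0 < Z t := expsum_gt0 t.
have := slope_le t01; have := expsum_moment1_le t; have := expsum_moment2_le t.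
rewrite -/Z -/Z1 -/Z2 => h2 h1 hG.
have p1 := profile1_ge0 prof Z0; have p2 := profile2_le0 prof Z0.
have p2' := profile2_ge prof Z0; have p3 := profile3_le prof Z0.
have bt := bZ t; have bt0 := b0 t; have kr := k_le i.
have r0 : 0 <= r := le_trans (normr_ge0 _) kr.
have Zr : 0 <= r * Z t by rewrite mulr_ge0// ltW.
have Zr2 : 0 <= r ^+ 2 * Z t by rewrite mulr_ge0 ?exprn_ge0// ltW.
have q2 : `|P2 (Z t)| * Z t <= P1 (Z t) by rewrite (ler0_norm p2) mulNr lerNl mulrC.
have q3 : `|P3 (Z t)| * Z t ^+ 2 <= 3 * P1 (Z t).
  by apply: le_trans p3; rewrite normrM (ger0_norm (sqr_ge0 (Z t))) mulrC.
pose S := r ^+ 2 * (Z t * P1 (Z t)).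
have n0 := normr_ge0.
have e3 : `|P3 (Z t) * Z1 t ^+ 2 * b t| <= 3 * S.
  rewrite normrM [X in X * _]normrM normrX (ger0_norm bt0).
  apply: (@le_trans _ _ (`|P3 (Z t)| * (r * Z t) ^+ 2 * Z t)).
    by rewrite !ler_pM ?mulr_ge0 ?exprn_ge0// lerXn2r// nnegrE.
  have -> : `|P3 (Z t)| * (r * Z t) ^+ 2 * Z t =
    (r ^+ 2 * Z t) * (`|P3 (Z t)| * Z t ^+ 2) by ring.
  apply: le_trans (ler_wpM2l Zr2 q3) _.
  by rewrite /S le_eqVlt; apply/predU1P; left; ring.
have e2 : `|P2 (Z t) * Z2 t * b t| <= S.
  rewrite !normrM (ger0_norm bt0).
  apply: (@le_trans _ _ (`|P2 (Z t)| * (r ^+ 2 * Z t) * Z t)).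
    by rewrite !ler_pM ?mulr_ge0.
  have -> : `|P2 (Z t)| * (r ^+ 2 * Z t) * Z t =
    (r ^+ 2 * Z t) * (`|P2 (Z t)| * Z t) by ring.
  by apply: le_trans (ler_wpM2l Zr2 q2) _; rewrite /S mulrA.
have e1 : `|P2 (Z t) * Z1 t * (b t * k i)| <= S.
  rewrite !normrM (ger0_norm bt0).
  apply: (@le_trans _ _ (`|P2 (Z t)| * (r * Z t) * (Z t * r))).
    by rewrite !ler_pM ?mulr_ge0.
  have -> : `|P2 (Z t)| * (r * Z t) * (Z t * r) =
    (r ^+ 2 * Z t) * (`|P2 (Z t)| * Z t) by ring.
  by apply: le_trans (ler_wpM2l Zr2 q2) _; rewrite /S mulrA.
have e0 : `|P1 (Z t) * (b t * k i ^+ 2)| <= S.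
  rewrite normrM [X in _ * X]normrM normrX (ger0_norm bt0) (ger0_norm p1).
  apply: (@le_trans _ _ (P1 (Z t) * (Z t * r ^+ 2))).
    by rewrite !ler_pM ?mulr_ge0 ?exprn_ge0// lerXn2r// nnegrE.
  by rewrite /S le_eqVlt; apply/predU1P; left; ring.
have SG : S <= r ^+ 2 * G by rewrite /S ler_wpM2l// sqr_ge0.
apply: le_trans (ler_normD _ _) _; apply: le_trans (lerD (ler_normD _ _) (lexx _)) _.
apply: le_trans (lerD (lerD (ler_normD _ _) (lexx _)) (lexx _)) _.
rewrite [X in _ + _ + X + _]normrM (ger0_norm (ler0n _ 2)).
lra.
Qed.

End ExponentialSums.

(** * The transport term *)

Lemma normr_coord_le (R : realType) (n : nat) (v : 'rV[R]_n) (j : 'I_n) :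
  `|v 0 j| <= `|v|.
Proof.
rewrite -[leRHS]/(mx_norm v) mx_normrE.
exact: (@le_bigmax _ _ _ 0 (fun ij : 'I_1 * 'I_n => `|v ij.1 ij.2|) (ord0, j)).
Qed.

Lemma differentiable_row (R : realType) (m n : nat)
    (f : 'I_n -> 'rV[R]_m -> R) (g : 'rV[R]_m) :
  (forall j, differentiable (f j) g) ->
  differentiable (fun h => \row_j f j h : 'rV[R]_n) g.
Proof.
move=> df.
have -> : (fun h => \row_j f j h) =
    \sum_j (fun h => f j h *: (delta_mx 0 j : 'rV[R]_n)).
  apply/funext => h; rewrite fct_sumE [LHS]row_sum_delta.
  by apply: eq_bigr => j _; rewrite mxE.
by apply: differentiable_sum => j; exact: differentiableZl.
Qed.

Lemma continuous_mul (R : realType) (T : topologicalType) (f g : T -> R) :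
  continuous f -> continuous g -> continuous (fun x => f x * g x).
Proof. by move=> cf cg x; exact: (continuousM (cf x) (cg x)). Qed.

Lemma continuous_add (R : realType) (T : topologicalType) (f g : T -> R) :
  continuous f -> continuous g -> continuous (fun x => f x + g x).
Proof. by move=> cf cg x; exact: (continuousD (cf x) (cg x)). Qed.

Section TransportTerm.
Context {R : realType} {n : nat} {X : ptopologicalType} {Y : Type}.
Variables (mu : {finite_measure set (borel X) -> \bar R}).
Variables (beta : 'I_n -> R) (y : 'I_n -> Y) (c : X -> Y -> R) (eps : R).
Variables P P1 P2 P3 : R -> R.
Hypothesis n_gt0 : (0 < n)%N.
Hypothesis beta_gt0 : forall j, 0 < beta j.
Hypothesis c_ge0 : forall x z, 0 <= c x z.
Hypothesis c_cont : forall j, continuous (fun x => c x (y j)).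
Hypothesis eps_gt0 : 0 < eps.
Hypothesis prof : elastic_profile P P1 P2 P3.
Implicit Types (x : X) (g h v : 'rV[R]_n) (i j : 'I_n).

Local Notation Bt := (Bterm beta y c eps).
Local Notation Z := (Zsum beta y c eps).

Lemma Bterm_gt0 j x g : 0 < Bt j x g.
Proof. by rewrite mulr_gt0// expR_gt0. Qed.

Lemma Zsum_gt0 x g : 0 < Z x g.
Proof.
rewrite /Zsum (bigD1 (Ordinal n_gt0))//= ltr_pwDl ?Bterm_gt0//.
by apply: sumr_ge0 => i _; exact/ltW/Bterm_gt0.
Qed.

Lemma Bterm_le_Zsum j x g : Bt j x g <= Z x g.
Proof.
rewrite /Zsum (bigD1 j)//= lerDl; apply: sumr_ge0 => i _.
exact/ltW/Bterm_gt0.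
Qed.

Lemma Bterm_line j x g v t :
  Bt j x (g + t *: v) = Bt j x g * expR (t * (v 0 j / eps)).
Proof.
rewrite /Bterm !mxE -mulrA -expRD; congr (_ * expR _).
by field; rewrite gt_eqF.
Qed.

Lemma Zsum_line x g v t :
  Z x (g + t *: v) = expsum (fun j => v 0 j / eps) (fun j => Bt j x g) t.
Proof. by apply: eq_bigr => j _; exact: Bterm_line. Qed.

(** An upper bound for [Z x] on the unit ball around [g] that is uniform in [x]:
    it drops the nonnegative cost from the exponents. *)
Definition Zsup g : R := \sum_j beta j * expR ((g 0 j + 1) / eps).

Lemma Zsum_le_Zsup x g v : `|v| <= 1 -> Z x (g + v) <= Zsup g.
Proof.
move=> v1; apply: ler_sum => j _; rewrite ler_pM2l// ler_expR ler_pM2r ?invr_gt0//.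
rewrite mxE; have := normr_coord_le v j; have := c_ge0 x (y j).
by have := ler_norm (v 0 j); lra.
Qed.

Lemma Zsum_le_Zsup0 x g : Z x g <= Zsup g.
Proof. by have := @Zsum_le_Zsup x g 0; rewrite normr0 addr0; exact. Qed.

Definition slope_sup g : R := Zsup g * P1 (Zsup g).

Lemma slope_le x g v : `|v| <= 1 ->
  Z x (g + v) * P1 (Z x (g + v)) <= slope_sup g.
Proof.
by move=> v1; apply: (profile_slope_le prof (Zsum_gt0 _ _)); exact: Zsum_le_Zsup.
Qed.

Lemma slope_le0 x g : Z x g * P1 (Z x g) <= slope_sup g.
Proof. by have := @slope_le x g 0; rewrite normr0 addr0; exact. Qed.

Lemma continuous_Bterm j g : continuous (fun x => Bt j x g).
Proof.
apply: continuous_mul; first exact: cst_continuous.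
move=> x; apply: (@continuous_comp _ _ _ (fun x => (g 0 j - c x (y j)) / eps) expR);
  last exact: continuous_expR.
apply: continuous_mul; last exact: cst_continuous.
apply: continuous_add; first exact: cst_continuous.
by move=> z; apply: continuousN; exact: c_cont.
Qed.

Lemma continuous_Zsum g : continuous (fun x => Z x g).
Proof.
apply: (@continuous_big R 'I_n +%R 0 xpredT (@add_continuous R)) => j _.
exact: continuous_Bterm.
Qed.

Lemma continuous_of_Zsum (f f1 : R -> R) g :
  (forall z : R, 0 < z -> is_derive z 1 f (f1 z)) ->
  continuous (fun x => f (Z x g)).
Proof.
move=> df x; apply: (@continuous_comp _ _ _ (fun x => Z x g) f).
  exact: continuous_Zsum.
apply/differentiable_continuous/derivable1_diffP.
exact: (@ex_derive _ _ _ _ _ _ _ (df _ (Zsum_gt0 x g))).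
Qed.

Definition transport g : R := \int[mu]_x P (Z x g).

(** The partial derivatives of the integrand [P (Z x g)]: the [j]-th one, and
    below the [i]-th derivative of the [j]-th one. *)
Definition transport_grad j x g : R := P1 (Z x g) * (Bt j x g / eps).

Definition transport_hess j i x g : R :=
  P2 (Z x g) * (Bt i x g / eps) * (Bt j x g / eps) +
  (i == j)%:R * (P1 (Z x g) * (Bt j x g / eps) / eps).

Lemma integrable_transport g :
  mu.-integrable setT (EFin \o (fun x => P (Z x g))).
Proof.
apply: (@integrable_continuous_bounded _ _ _ _ (P (Zsup g))).
  exact: continuous_of_Zsum (profile_derive prof).
move=> x; rewrite ger0_norm ?(profile_ge0 prof) ?Zsum_gt0//.
by apply: (profile_le prof (Zsum_gt0 _ _)); exact: Zsum_le_Zsup0.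
Qed.

Lemma continuous_transport_grad j g : continuous (transport_grad j ^~ g).
Proof.
apply: continuous_mul; first exact: continuous_of_Zsum (profile_derive1 prof).
by apply: continuous_mul; [exact: continuous_Bterm|exact: cst_continuous].
Qed.

Lemma transport_grad_ge0 j x g : 0 <= transport_grad j x g.
Proof.
have z0 := Zsum_gt0 x g; have b0 := Bterm_gt0 j x g.
by rewrite mulr_ge0 ?(profile1_ge0 prof)// divr_ge0// ltW.
Qed.

Lemma transport_grad_le j x g : transport_grad j x g <= slope_sup g / eps.
Proof.
rewrite /transport_grad mulrA ler_pM2r ?invr_gt0//.
apply: le_trans (slope_le0 x g); rewrite mulrC ler_wpM2r ?Bterm_le_Zsum//.
by rewrite (profile1_ge0 prof)// Zsum_gt0.
Qed.

Lemma integrable_transport_grad j g :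
  mu.-integrable setT (EFin \o (transport_grad j ^~ g)).
Proof.
apply: integrable_continuous_bounded; first exact: continuous_transport_grad.
by move=> x; rewrite ger0_norm ?transport_grad_ge0//; exact: transport_grad_le.
Qed.

Lemma integrable_transport_hess j i g :
  mu.-integrable setT (EFin \o (transport_hess j i ^~ g)).
Proof.
have cB l : continuous (fun x => Bt l x g / eps).
  by apply: continuous_mul; [exact: continuous_Bterm|exact: cst_continuous].
apply: (@integrable_continuous_bounded _ _ _ _ (2 * (slope_sup g / eps / eps))).
  apply: continuous_add.
    apply: continuous_mul (cB j); apply: continuous_mul (cB i).
    exact: continuous_of_Zsum (profile_derive2 prof).
  apply: continuous_mul; first exact: cst_continuous.
  apply: continuous_mul; last exact: cst_continuous.
  exact: continuous_transport_grad.
move=> x; have z0 := Zsum_gt0 x g; have p2 := profile2_le0 prof z0.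
have p2' := profile2_ge prof z0; have e0 : 0 <= eps^-1 by rewrite invr_ge0 ltW.
have bi0 := ltW (Bterm_gt0 i x g); have bj0 := ltW (Bterm_gt0 j x g).
have q2 : `|P2 (Z x g)| * Z x g <= P1 (Z x g).
  by rewrite (ler0_norm p2) mulNr lerNl mulrC.
apply: le_trans (ler_normD _ _) _; rewrite [leRHS]mulr_natl mulr2n lerD//.
  have bie0 : 0 <= Bt i x g / eps by rewrite mulr_ge0.
  have bje0 : 0 <= Bt j x g / eps by rewrite mulr_ge0.
  rewrite 2!normrM (ger0_norm bie0) (ger0_norm bje0).
  apply: (@le_trans _ _ (`|P2 (Z x g)| * (Z x g / eps) * (Z x g / eps))).
    rewrite ler_pM//; first by rewrite mulr_ge0.
      by rewrite ler_wpM2l// ler_wpM2r// Bterm_le_Zsum.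
    by rewrite ler_wpM2r// Bterm_le_Zsum.
  have -> : `|P2 (Z x g)| * (Z x g / eps) * (Z x g / eps) =
      (Z x g * (`|P2 (Z x g)| * Z x g)) / eps / eps by ring.
  rewrite !ler_wpM2r//; apply: le_trans (slope_le0 x g).
  by rewrite ler_wpM2l// ltW.
rewrite -/(transport_grad j x g) normrM.
have t0 : 0 <= transport_grad j x g / eps.
  by rewrite mulr_ge0// transport_grad_ge0.
rewrite (ger0_norm t0); apply: (@le_trans _ _ (transport_grad j x g / eps)).
  by rewrite ler_piMl// normr_nat lern1 leq_b1.
by rewrite ler_wpM2r// transport_grad_le.
Qed.

Let coord_div_le v j : `|v 0 j / eps| <= `|v| / eps.
Proof.
have e0 : 0 <= eps^-1 by rewrite invr_ge0 ltW.
rewrite normrM (ger0_norm e0).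
by rewrite ler_pM2r ?invr_gt0// normr_coord_le.
Qed.

Let slope_line x g v (t : R) : `|v| <= 1 -> 0 <= t <= 1 ->
  expsum (fun j => v 0 j / eps) (fun j => Bt j x g) t *
  P1 (expsum (fun j => v 0 j / eps) (fun j => Bt j x g) t) <= slope_sup g.
Proof.
move=> v1 /andP[t0 t1]; rewrite -Zsum_line; apply: slope_le.
by rewrite normrZ ger0_norm// mulr_ile1.
Qed.

Lemma transport_diff g :
  differentiable transport g /\
  forall j, 'D_(delta_mx 0 j) transport g = \int[mu]_x transport_grad j x g.
Proof.
apply: (@differentiable_Rintegral _ _ _ mu n (fun x g => P (Z x g)) g
  (fun j => transport_grad j ^~ g) (2 * slope_sup g / eps ^+ 2)).
- exact: integrable_transport.
- by move=> j; exact: integrable_transport_grad.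
move=> x v v1.
have := expsum_value_taylor n_gt0 (fun j => Bterm_gt0 j x g) (coord_div_le v)
  prof (fun t => @slope_line x g v t v1).
rewrite -!Zsum_line scale1r scale0r addr0.
have -> : P1 (Z x g) * expsum (fun j => v 0 j / eps)
    (fun i => Bt i x g * (v 0 i / eps)) 0 = \sum_j transport_grad j x g * v 0 j.
  rewrite /expsum mulr_sumr; apply: eq_bigr => j _.
  by rewrite mul0r expR0 /transport_grad; ring.
move=> /le_trans; apply; rewrite expr_div_n.
by rewrite le_eqVlt; apply/predU1P; left; ring.
Qed.

Lemma transport_grad_diff j g :
  differentiable (fun h => \int[mu]_x transport_grad j x h) g /\
  forall i, 'D_(delta_mx 0 i) (fun h => \int[mu]_x transport_grad j x h) g =
    \int[mu]_x transport_hess j i x g.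
Proof.
apply: (@differentiable_Rintegral _ _ _ mu n (transport_grad j) g
  (fun i => transport_hess j i ^~ g) (7 * slope_sup g / eps ^+ 3)).
- exact: integrable_transport_grad.
- by move=> i; exact: integrable_transport_hess.
move=> x v v1.
have := expsum_slope_taylor n_gt0 (fun j => Bterm_gt0 j x g) (coord_div_le v)
  prof (fun t => @slope_line x g v t v1) j.
rewrite /= -!Zsum_line -!Bterm_line scale1r scale0r addr0.
set S := expsum _ _ 0 => H.
have -> : \sum_i transport_hess j i x g * v 0 i =
    (P2 (Z x g) * S * Bt j x g + P1 (Z x g) * (Bt j x g * (v 0 j / eps))) / eps.
  rewrite /transport_hess; under eq_bigr do rewrite mulrDl.
  rewrite big_split /= mulrDl; congr (_ + _).
    rewrite /S /expsum mulr_sumr !mulr_suml; apply: eq_bigr => i _.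
    by rewrite mul0r expR0; ring.
  rewrite (bigD1 j)//= big1 ?addr0; last by move=> i /negbTE ->; rewrite !mul0r.
  by rewrite eqxx /=; ring.
set A := P2 _ * _ * _ + _ in H *.
have -> : transport_grad j x (g + v) - transport_grad j x g - A / eps =
    (P1 (Z x (g + v)) * Bt j x (g + v) - P1 (Z x g) * Bt j x g - A) / eps.
  by rewrite /transport_grad; ring.
have e0 : 0 <= eps^-1 by rewrite invr_ge0 ltW.
have -> : 7 * slope_sup g / eps ^+ 3 * `|v| ^+ 2 =
   (7 * (`|v| / eps) ^+ 2 * slope_sup g) / eps by field; rewrite gt_eqF.
by rewrite normrM (ger0_norm e0) ler_wpM2r.
Qed.

(** The pointwise bounds on the quadratic form of the Hessian are integrated
    here.  The lower one is the Cauchy-Schwarz inequality with weights [B_i] and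
    [- P1 <= z P2]; the upper one drops the nonpositive term in [P2]. *)
Lemma transport_hess_form g (v : 'cV[R]_n) :
  0 <= \sum_i v i 0 * \sum_j v j 0 * \int[mu]_x transport_hess j i x g <=
  eps^-1 * \sum_i v i 0 ^+ 2 * \int[mu]_x transport_grad i x g.
Proof.
have inn i := Rintegral_lincomb (index_enum 'I_n) (fun j => v j 0)
  (fun j => integrable_transport_hess j i g).
have [iq eq_] := Rintegral_lincomb (index_enum 'I_n) (fun i => v i 0)
  (fun i => (inn i).1).
have [id ed] := Rintegral_lincomb (index_enum 'I_n) (fun i => v i 0 ^+ 2)
  (fun i => integrable_transport_grad i g).
under eq_bigr do rewrite -(inn _).2.
rewrite -eq_ -ed -RintegralZl//.
have qE x : \sum_i v i 0 * (\sum_j v j 0 * transport_hess j i x g) =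
   eps^-1 ^+ 2 * (P2 (Z x g) * (\sum_i Bt i x g * v i 0) ^+ 2 +
               P1 (Z x g) * \sum_i Bt i x g * v i 0 ^+ 2).
  set S := \sum_i Bt i x g * v i 0.
  transitivity (\sum_i (eps^-1 ^+ 2 * P2 (Z x g) * S * (Bt i x g * v i 0) +
                        eps^-1 ^+ 2 * P1 (Z x g) * (Bt i x g * v i 0 ^+ 2))).
    apply: eq_bigr => i _; rewrite /transport_hess.
    under eq_bigr do rewrite mulrDr.
    rewrite big_split /= mulrDr; congr (_ + _).
      rewrite /S [LHS]mulr_sumr [X in _ = X * _]mulr_sumr mulr_suml.
      by apply: eq_bigr => j _; ring.
    rewrite (bigD1 i)//= big1 ?addr0; last first.
      by move=> j ji; rewrite eq_sym (negbTE ji) mul0r mulr0.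
    by rewrite eqxx /=; ring.
  by rewrite big_split /= -!mulr_sumr -/S; ring.
have dE x : \sum_i v i 0 ^+ 2 * transport_grad i x g =
    eps^-1 * (P1 (Z x g) * \sum_i Bt i x g * v i 0 ^+ 2).
  by rewrite !mulr_sumr; apply: eq_bigr => i _; rewrite /transport_grad; ring.
have e0 : 0 < eps^-1 by rewrite invr_gt0.
apply/andP; split.
  apply: Rintegral_ge0 => x _; rewrite qE mulr_ge0 ?sqr_ge0//.
  have z0 := Zsum_gt0 x g.
  have := weighted_cauchy_schwarz (v ^~ 0) (fun i => ltW (Bterm_gt0 i x g)) z0.
  rewrite -/(Z x g); set s := (\sum_i _) ^+ 2; set q := \sum_i _ => cs.
  have p2 := profile2_le0 prof z0; have p2' := profile2_ge prof z0.
  have q0 : 0 <= q.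
    by apply: sumr_ge0 => i _; rewrite mulr_ge0 ?sqr_ge0// ltW// Bterm_gt0.
  have : P2 (Z x g) * (Z x g * q) <= P2 (Z x g) * s by rewrite ler_wnM2l.
  have := ler_wpM2r q0 p2'; lra.
apply: le_Rintegral => //.
  exact: (integrableZl measurableT eps^-1 id).
move=> x _; rewrite qE dE [leRHS]mulrA -expr2 ler_wpM2l ?sqr_ge0// gerDr.
by rewrite mulr_le0_ge0 ?sqr_ge0// (profile2_le0 prof)// Zsum_gt0.
Qed.

End TransportTerm.

(** * The semi-dual objective *)

Section QuadraticPenalty.
Context {R : realType} {n : nat}.
Variables (beta : 'I_n -> R) (rho2 : R).
Hypothesis rho2_gt0 : 0 < rho2.

Definition penalty (g : 'rV[R]_n) : R :=
  \sum_(j < n) beta j * (g 0 j ^+ 2 / (2 * rho2) - g 0 j).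

Definition penalty_grad j (g : 'rV[R]_n) : R := beta j * (g 0 j / rho2 - 1).

Lemma penalty_diff g :
  differentiable penalty g /\
  forall j, 'D_(delta_mx 0 j) penalty g = penalty_grad j g.
Proof.
apply: (@differentiable_quadratic_remainder _ _ _ _ _
  (\sum_j `|beta j / (2 * rho2)|)) => v _.
have -> : penalty (g + v) - penalty g - \sum_j penalty_grad j g * v 0 j =
    \sum_j beta j / (2 * rho2) * v 0 j ^+ 2.
  rewrite /penalty -!sumrB; apply: eq_bigr => j _; rewrite mxE /penalty_grad.
  by field; rewrite gt_eqF.
rewrite mulr_suml; apply: le_trans (ler_norm_sum _ _ _) _.
apply: ler_sum => j _; rewrite normrM normrX ler_wpM2l//.
by rewrite lerXn2r ?nnegrE// normr_coord_le.
Qed.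

Lemma penalty_grad_diff j g :
  differentiable (penalty_grad j) g /\
  forall i, 'D_(delta_mx 0 i) (penalty_grad j) g = (i == j)%:R * (beta j / rho2).
Proof.
apply: (@differentiable_quadratic_remainder _ _ _ _ _ 0) => v _.
have -> : \sum_i (i == j)%:R * (beta j / rho2) * v 0 i = beta j / rho2 * v 0 j.
  rewrite (bigD1 j)//= big1 ?addr0; last by move=> i /negbTE ->; rewrite !mul0r.
  by rewrite eqxx mul1r.
rewrite /penalty_grad mxE mul0r (_ : _ - _ = 0) ?normr0//.
by field; rewrite gt_eqF.
Qed.

End QuadraticPenalty.

(** The theorem for an arbitrary profile: the source divergence enters only
    through [elastic_profile]. *)
Lemma semidual_hessian_le (R : realType) (n : nat) (X : ptopologicalType)
    (Y : Type) (mu : {finite_measure set (borel X) -> \bar R})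
    (beta : 'I_n -> R) (y : 'I_n -> Y) (c : X -> Y -> R) (eps rho2 : R)
    (P P1 P2 P3 : R -> R) (g : 'rV[R]_n) :
  (0 < n)%N -> (forall j, 0 < beta j) -> (forall x z, 0 <= c x z) ->
  (forall j, continuous (fun x => c x (y j))) -> 0 < eps -> 0 < rho2 ->
  elastic_profile P P1 P2 P3 ->
  let Jt := transport mu beta y c eps P in
  let J h := Jt h + penalty beta rho2 h in
  [/\ differentiable Jt g, twice_differentiable J g &
      opnorm (hessian J g) <=
        eps^-1 * `|grad Jt g| + (\big[Num.max/0]_(j < n) beta j) / rho2].
Proof.
move=> n0 beta0 c0 cc eps0 rho0 prof Jt J.
have Td h := transport_diff mu n0 beta0 c0 cc eps0 prof h.
have Tg j h := transport_grad_diff mu n0 beta0 c0 cc eps0 prof j h.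
have Qd h := penalty_diff beta rho0 h.
have Qg j h := penalty_grad_diff beta rho0 j h.
pose G j h := \int[mu]_x transport_grad beta y c eps P1 j x h.
pose H j i h := \int[mu]_x transport_hess beta y c eps P1 P2 j i x h.
have derJ j : (fun h => 'D_(delta_mx 0 j) J h) = G j + penalty_grad beta rho2 j.
  apply/funext => h; rewrite deriveD; last first.
  - by apply: diff_derivable; exact: (Qd h).1.
  - by apply: diff_derivable; exact: (Td h).1.
  by rewrite (Td h).2 (Qd h).2.
have hessE i j : hessian J g i j = H j i g + (i == j)%:R * (beta j / rho2).
  rewrite mxE derJ deriveD; last first.
  - by apply: diff_derivable; exact: (Qg j g).1.
  - by apply: diff_derivable; exact: (Tg j g).1.
  by rewrite (Tg j g).2 (Qg j g).2.
split; first exact: (Td g).1.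
  split.
    apply: (@nearW _ (nbhs g)) => h.
    by apply: differentiableD; [exact: (Td h).1|exact: (Qd h).1].
  have -> : grad J = fun h => \row_j (G j + penalty_grad beta rho2 j) h.
    by apply/funext => h; apply/rowP => j; rewrite !mxE -derJ.
  apply: differentiable_row => j.
  by apply: differentiableD; [exact: (Tg j g).1|exact: (Qg j g).1].
set bm := \big[_/_]_(j < n) _.
have bm_ge j : beta j <= bm by exact: le_bigmax.
have bm_gt0 : 0 < bm := lt_le_trans (beta0 (Ordinal n0)) (bm_ge _).
move: (hessian J g) hessE => A hessE; apply: opnorm_psd_le.
- by rewrite ltr_wpDl ?divr_gt0// mulr_ge0 ?invr_ge0// ltW.
- apply/matrixP => i j; rewrite mxE !hessE [j == i]eq_sym.
  apply: (f_equal2 +%R); last first.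
    by case: eqVneq => [->//|_]; rewrite !mul0r.
  apply: eq_Rintegral => x _; rewrite /transport_hess eq_sym.
  by congr (_ + _); [ring|case: eqVneq => [->//|_]; rewrite !mul0r].
move=> v.
have formE : (v^T *m A *m v) 0 0 =
    \sum_i v i 0 * (\sum_j v j 0 * H j i g) + \sum_i beta i / rho2 * v i 0 ^+ 2.
  rewrite -mulmxA mxE -big_split /=; apply: eq_bigr => i _; rewrite !mxE.
  under [X in _ * X = _]eq_bigr do rewrite hessE mulrDl.
  rewrite big_split /= mulrDr; congr (_ * _ + _).
    by apply: eq_bigr => j _; rewrite mulrC.
  rewrite (bigD1 i)//= big1 ?addr0; last first.
    by move=> j ji; rewrite eq_sym (negbTE ji) !mul0r.
  by rewrite eqxx /=; ring.
have normE : (v^T *m v) 0 0 = \sum_i v i 0 ^+ 2.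
  by rewrite mxE; apply: eq_bigr => i _; rewrite mxE expr2.
have /andP[h0 h1] := transport_hess_form mu n0 beta0 c0 cc eps0 prof g v.
rewrite formE normE mulrDl; apply/andP; split.
  rewrite addr_ge0//; apply: sumr_ge0 => i _.
  by rewrite mulr_ge0 ?sqr_ge0// divr_ge0// ltW.
apply: lerD.
  apply: le_trans h1 _; rewrite -mulrA ler_wpM2l ?invr_ge0 ?(ltW eps0)//.
  rewrite mulr_sumr; apply: ler_sum => i _; rewrite mulrC ler_wpM2r ?sqr_ge0//.
  have := normr_coord_le (grad Jt g) i; rewrite mxE (Td g).2.
  by apply: le_trans; exact: ler_norm.
rewrite mulr_sumr; apply: ler_sum => i _.
by rewrite ler_wpM2r ?sqr_ge0// ler_wpM2r ?invr_ge0 ?(ltW rho0).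
Qed.

Theorem theorem3 (R : realType) (X : ptopologicalType) (Y : topologicalType)
  (polX : @polish_space R X) (polY : @polish_space R Y)
  (mu : {finite_measure set (borel X) -> \bar R})
  (n : nat) (n_gt0 : (0 < n)%N)
  (b B : R) (b_gt0 : 0 < b) (bB : b <= B)
  (beta : 'I_n -> R) (y : 'I_n -> Y)
  (beta_gt0 : forall j, 0 < beta j)
  (beta_bounds : forall j, b / n%:R <= beta j <= B / n%:R)
  (c : X -> Y -> R) (c_ge0 : forall x z, 0 <= c x z)
  (c_cont : continuous (fun p : X * Y => c p.1 p.2))
  (eps rho1 rho2 : R) (eps_gt0 : 0 < eps) (rho1_gt0 : 0 < rho1)
  (rho2_gt0 : 0 < rho2) (s : source_divergence) (g : 'rV[R]_n) :
  let Jt := Jtrans mu beta y c eps rho1 s in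
  let J := Jdual mu beta y c eps rho1 rho2 s in
  let beta_max := \big[Num.max/0]_(j < n) beta j in
  (* the derivatives involved exist, and satisfy the bound; [`|_|] is the
     sup norm on row vectors *)
  [/\ differentiable Jt g,
      twice_differentiable J g &
      opnorm (hessian J g) <= eps^-1 * `|grad Jt g| + beta_max / rho2].
Proof.
have cy_cont j : continuous (fun x => c x (y j)).
  move=> x; apply: (@continuous_comp _ _ _ (fun x => (x, y j))
    (fun p : X * Y => c p.1 p.2)); last exact: c_cont.
  by apply: cvg_pair; [exact: cvg_id|exact: cvg_cst].
(* The constant in front of the integral moves inside because the scaled
   profile is integrable. *)
have JtE (k : R) (f P P1 P2 P3 : R -> R) : k != 0 -> elastic_profile P P1 P2 P3 ->
    P = (fun z => k * f z) ->
    (fun h => k * \int[mu]_x f (Zsum beta y c eps x h)) =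
    transport mu beta y c eps P.
  move=> k0 prof PE; apply/funext => h; rewrite /transport.
  have iP := integrable_transport mu n_gt0 beta_gt0 c_ge0 cy_cont eps_gt0 prof h.
  have -> : \int[mu]_x f (Zsum beta y c eps x h) =
      \int[mu]_x (k^-1 * P (Zsum beta y c eps x h)).
    by apply: eq_Rintegral => x _; rewrite PE mulKf.
  by rewrite RintegralZl// mulVKf.
have main P P1 P2 P3 : elastic_profile P P1 P2 P3 ->
    Jtrans mu beta y c eps rho1 s = transport mu beta y c eps P ->
    [/\ differentiable (Jtrans mu beta y c eps rho1 s) g,
      twice_differentiable (Jdual mu beta y c eps rho1 rho2 s) g &
      opnorm (hessian (Jdual mu beta y c eps rho1 rho2 s) g) <=
      eps^-1 * `|grad (Jtrans mu beta y c eps rho1 s) g| +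
      (\big[Num.max/0]_(j < n) beta j) / rho2].
  move=> prof E; rewrite /Jdual E.
  exact: (semidual_hessian_le mu g n_gt0 beta_gt0 c_ge0 cy_cont eps_gt0
    rho2_gt0 prof).
move=> Jt J beta_max; rewrite /Jt /J /beta_max; case: s main {Jt J} => main.
- have k0 : 0 < rho1 + eps by rewrite addr_gt0.
  have er0 : 0 < eps + rho1 by rewrite addr_gt0.
  have a01 : 0 <= eps / (eps + rho1) <= 1.
    rewrite (divr_ge0 (ltW eps_gt0) (ltW er0)) /=.
    by rewrite ler_pdivrMr// mul1r lerDl ltW.
  have prof := powR_profile (ltW k0) a01.
  apply: main (prof) _.
  by apply: (JtE _ (fun z => z `^ _) _ _ _ _ _ prof); rewrite ?gt_eqF.
- have m0 : 0 < eps ^+ 2 / rho1 by rewrite divr_gt0// exprn_gt0.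
  have k0 : 0 < rho1 / eps * expR (rho1 / eps).
    by rewrite mulr_gt0 ?expR_gt0 ?divr_gt0.
  have prof := lambert_profile (ltW m0) k0.
  apply: main (prof) _.
  exact: (JtE _ (fun z => lambertW (rho1 / eps * expR (rho1 / eps) * z) +
    2^-1 * lambertW (rho1 / eps * expR (rho1 / eps) * z) ^+ 2)
    _ _ _ _ (lt0r_neq0 m0) prof).
Qed.
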